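(* Let $\{x^k\}$ be generated by the MCondG algorithm with the tight adaptive step size $t_k=t_k^{\rm TAS}$. Then there exists $\widehat{L}\in(0,L_{\max}]$ such that, for all $k\ge0$, $$F(x^k+t_k^{\rm TAS}d^k)-F(x^k)\preceq-\frac12\min\left\{-\theta(x^k),\frac{\theta(x^k)^2}{\widehat{L}D^2}\right\}e.$$
   Context: Notation: $\langle m\rangle=\{1,2,\dots,m\}$; $\langle\cdot,\cdot\rangle$ and $\|\cdot\|$ are the standard inner product and Euclidean norm on $\mathbb{R}^n$; $e=(1,\dots,1)^\top\in\mathbb{R}^m$; for $u,v\in\mathbb{R}^m$, $u\preceq v$ means $v-u\in\mathbb{R}^m_+$ (componentwise inequality). Problem: $F=(f_1,\dots,f_m)^\top:\mathbb{R}^n\to\mathbb{R}^m$ is continuously differentiable and $\Omega\subset\mathbb{R}^n$ is a nonempty compact convex set with diameter $D=\max\{\|x-y\|:x,y\in\Omega\}$. For each $i\in\langle m\rangle$ there is a constant $L_i>0$ with $\|\nabla f_i(x)-\nabla f_i(y)\|\le L_i\|x-y\|$ for all $x,y\in\Omega$. Put $L_{\max}=\max_{i\in\langle m\rangle}L_i$. For $x\in\Omega$, let $p(x)\in\arg\min_{p\in\Omega}\max_{i\in\langle m\rangle}\langle\nabla f_i(x),p-x\rangle$ (some minimizer), $d(x)=p(x)-x$, and $\theta(x)=\max_{i\in\langle m\rangle}\langle\nabla f_i(x),p(x)-x\rangle$. The multiobjective conditional gradient (MCondG) algorithm starts from $x^0\in\Omega$ and iterates $x^{k+1}=x^k+t_kd^k$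 with $d^k=d(x^k)$ and a step size $t_k\in(0,1]$; it stops if $\theta(x^k)=0$. It is assumed that it does not terminate, i.e. $\theta(x^k)<0$ for all $k\ge0$ (in particular $d^k\neq0$). For $t\in[0,1]$ define $$g_{i,k}(t)=\tfrac12L_i\|d^k\|^2t^2+\langle\nabla f_i(x^k),d^k\rangle t\quad(i\in\langle m\rangle),\qquad g_k(t)=\max_{i\in\langle m\rangle}g_{i,k}(t).$$ The tight adaptive step size $t_k^{\rm TAS}$ is the unique minimizer of $g_k$ over $[0,1]$. *)

(* Defs.v *)
From mathcomp Require Import all_boot all_order all_algebra.
From mathcomp Require Import all_classical all_reals all_analysis.

Set Implicit Arguments.
Unset Strict Implicit.
Unset Printing Implicit Defensive.

Import Order.TTheory GRing.Theory Num.Theory.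
Import numFieldNormedType.Exports.

Local Open Scope classical_set_scope.
Local Open Scope ring_scope.

(* Points of R^n are row vectors ['rV[R]_n].  The library norm [`|u|] on
   ['rV[R]_n] is the sup norm; it is used only through the topology it induces
   (compactness, differentiability, continuity).  All metric quantities use the
   Euclidean norm [enorm] below. *)
Section Euclidean.
Variables (R : realType) (n : nat).
Implicit Types u v : 'rV[R]_n.

Definition dotp u v : R := \sum_(j < n) u 0 j * v 0 j.

Definition enorm u : R := Num.sqrt (dotp u u).

(* For a nonempty compact set this supremum is a maximum. *)
Definition diameter (A : set 'rV[R]_n) : R :=
  sup [set r | exists x y, [/\ A x, A y & r = enorm (x - y)]].

Definition vle u v : Prop := forall j, u 0 j <= v 0 j.

Definition gradient (f : 'rV[R]_n -> R) (x : 'rV[R]_n) : 'rV[R]_n :=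
  \row_(j < n) 'D_(delta_mx 0 j) f x.

End Euclidean.

(* Maximum of a finite nonempty family; the initial value [v ord0] is itself a
   member of the family. *)
Definition fmax (R : realType) (m : nat) (v : 'I_m.+1 -> R) : R :=
  \big[Num.max/v ord0]_(i < m.+1) v i.

Definition argmin (R : realType) (T : Type) (A : set T) (h : T -> R) : set T :=
  [set a | A a /\ forall b, A b -> h a <= h b].

Definition continuously_differentiable (R : realType) (n m : nat)
    (F : 'rV[R]_n -> 'rV[R]_m) : Prop :=
  (forall x, differentiable F x) /\ continuous (fun x => 'J F x).

(* There are [m.+1] objectives, so that the index set is nonempty. *)
Section MCondG.
Variables (R : realType) (n m : nat).
Variable F : 'rV[R]_n -> 'rV[R]_m.+1.
Implicit Types (x y q : 'rV[R]_n) (Omega : set 'rV[R]_n).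

Definition objective (i : 'I_m.+1) : 'rV[R]_n -> R := fun x => F x 0 i.

Definition lin_max x q : R :=
  fmax (fun i => dotp (gradient (objective i) x) (q - x)).

Definition lipschitz_gradients Omega (L : 'I_m.+1 -> R) : Prop :=
  forall i, 0 < L i /\
    forall x y, Omega x -> Omega y ->
      enorm (gradient (objective i) x - gradient (objective i) y)
        <= L i * enorm (x - y).

(* [p] selects, at every feasible point, one minimizer of the subproblem. *)
Definition subproblem_solution Omega (p : 'rV[R]_n -> 'rV[R]_n) : Prop :=
  forall x, Omega x -> argmin Omega (lin_max x) (p x).

Variable p : 'rV[R]_n -> 'rV[R]_n.

Definition direction x : 'rV[R]_n := p x - x.

Definition theta x : R := lin_max x (p x).

Definition mcondg_sequence Omega (t : nat -> R) (x : nat -> 'rV[R]_n) : Prop :=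
  Omega (x 0%N) /\
  forall k, 0 < t k <= 1 /\ x k.+1 = x k + t k *: direction (x k).

Definition quad_model (L : 'I_m.+1 -> R) x (i : 'I_m.+1) (s : R) : R :=
  2^-1 * L i * enorm (direction x) ^+ 2 * s ^+ 2
    + dotp (gradient (objective i) x) (direction x) * s.

Definition max_model (L : 'I_m.+1 -> R) x (s : R) : R :=
  fmax (fun i => quad_model L x i s).

(* When [direction x != 0] the model is strictly convex, so that its minimizer
   over [0, 1] is unique. *)
Definition tight_adaptive_step (L : 'I_m.+1 -> R) x (s : R) : Prop :=
  argmin `[0, 1] (max_model L x) s.

End MCondG.

(* Main.v *)
(** Each objective lies below its quadratic upper model on the segment from
    [x k] to [p (x k)], and hence below the common majorant
    [max_model <= Lmax / 2 * |d|^2 * s^2 + theta * s].  The step [t k] minimizes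
    [max_model], so any trial [s] in [0, 1] bounds the decrease from above; the
    minimizer [min 1 (- theta / (Lmax * |d|^2))] of the common majorant gives
    the claim with [Lhat = Lmax]. *)

Require Import Defs.
From mathcomp Require Import all_boot all_order all_algebra.
From mathcomp Require Import all_classical all_reals all_analysis.
From mathcomp Require Import ring lra.

Import Order.TTheory GRing.Theory Num.Theory.
Import numFieldNormedType.Exports.

Local Open Scope classical_set_scope.
Local Open Scope ring_scope.

Lemma dotpC (R : realType) n (u v : 'rV[R]_n) : dotp u v = dotp v u.
Proof. by apply: eq_bigr => j _; rewrite mulrC. Qed.

Lemma dotpDl (R : realType) n (u v w : 'rV[R]_n) :
  dotp (u + v) w = dotp u w + dotp v w.
Proof. by rewrite -big_split; apply: eq_bigr => j _; rewrite !mxE mulrDl. Qed.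

Lemma dotpZl (R : realType) n (a : R) (u v : 'rV[R]_n) :
  dotp (a *: u) v = a * dotp u v.
Proof. by rewrite big_distrr; apply: eq_bigr => j _; rewrite !mxE -mulrA. Qed.

Lemma dotpBl (R : realType) n (u v w : 'rV[R]_n) :
  dotp (u - v) w = dotp u w - dotp v w.
Proof. by rewrite -[- v]scaleN1r dotpDl dotpZl mulN1r. Qed.

Lemma dotp_ge0 (R : realType) n (u : 'rV[R]_n) : 0 <= dotp u u.
Proof. by apply: sumr_ge0 => j _; rewrite -expr2 sqr_ge0. Qed.

Lemma dotp_eq0 (R : realType) n (u : 'rV[R]_n) : dotp u u = 0 -> u = 0.
Proof.
move/eqP; rewrite psumr_eq0 => [/allP u0|j _]; last by rewrite -expr2 sqr_ge0.
apply/rowP => j; have := u0 j; rewrite mem_index_enum => /(_ isT).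
by rewrite mulf_eq0 orbb mxE => /eqP.
Qed.

Lemma enorm_ge0 (R : realType) n (u : 'rV[R]_n) : 0 <= enorm u.
Proof. exact: sqrtr_ge0. Qed.

Lemma enorm_sqr (R : realType) n (u : 'rV[R]_n) : enorm u ^+ 2 = dotp u u.
Proof. by rewrite sqr_sqrtr// dotp_ge0. Qed.

Lemma enormZ (R : realType) n (a : R) (u : 'rV[R]_n) :
  0 <= a -> enorm (a *: u) = a * enorm u.
Proof.
move=> a0; rewrite /enorm dotpZl dotpC dotpZl mulrA -expr2.
by rewrite sqrtrM ?sqr_ge0// sqrtr_sqr ger0_norm.
Qed.

(** Cauchy-Schwarz inequality. With $A = \langle u,u\rangle > 0$, expanding $0 \le \|Av - \langle
    u,v\rangle u\|^2 = A(A\|v\|^2 - \langle u,v\rangle^2)$ and dividing by $A$ gives it; if $A = 0$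
    then $u = 0$. *)
Lemma dotp_le_enorm (R : realType) n (u v : 'rV[R]_n) :
  dotp u v <= enorm u * enorm v.
Proof.
have [A0|A_neq0] := eqVneq (dotp u u) 0.
  rewrite (dotp_eq0 _ _ _ A0) -(scale0r (0 : 'rV[R]_n)) dotpZl mul0r.
  by rewrite mulr_ge0 ?enorm_ge0.
apply: le_trans (ler_norm _) _.
rewrite -(@ler_pXn2r _ 2) ?nnegrE ?mulr_ge0 ?enorm_ge0//.
rewrite exprMn !enorm_sqr real_normK ?num_real//.
have A_gt0 : 0 < dotp u u by rewrite lt_def A_neq0 dotp_ge0.
have := dotp_ge0 _ _ (dotp u u *: v - dotp u v *: u).
rewrite dotpBl !dotpZl [dotp v _]dotpC [dotp u (_ - _)]dotpC.
rewrite !dotpBl !dotpZl [dotp v u]dotpC => h.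
rewrite -subr_ge0 -(pmulr_rge0 _ A_gt0).
by apply: le_trans h _; rewrite le_eqVlt; apply/orP; left; apply/eqP; ring.
Qed.

Lemma diameter_ge (R : realType) n (A : set 'rV[R]_n) x y :
  compact A -> A x -> A y -> enorm (x - y) <= diameter A.
Proof.
move=> cA Ax Ay; apply: ub_le_sup; last by exists x, y.
have dotp_cont : continuous (fun u : 'rV[R]_n => dotp u u).
  move=> u; apply: differentiable_continuous.
  rewrite /dotp -fct_sumE; apply: differentiable_sum => j.
  by apply: differentiableM; apply: differentiable_coord.
have [c _ c_max] :=
  EVT_max_rV (ex_intro _ x Ax) cA (continuous_subspaceT dotp_cont).
(* The supremum is an upper bound only for a bounded set of distances. Here $\|a-b\|^2 \le 2\|a\|^2
   + 2\|b\|^2 \le 4\|c\|^2$, with [c] a point of [A] of largest norm. *)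
exists (Num.sqrt (4 * dotp c c)) => _ [a [b [Aa Ab ->]]].
rewrite ler_sqrt ?mulr_ge0 ?dotp_ge0//.
have := c_max a; rewrite inE => /(_ Aa) ca.
have := c_max b; rewrite inE => /(_ Ab) cb.
rewrite dotpBl ![dotp _ (a - b)]dotpC !dotpBl [dotp b a]dotpC.
have := dotp_ge0 _ _ (a + b).
rewrite dotpDl ![dotp _ (a + b)]dotpC !dotpDl [dotp b a]dotpC; lra.
Qed.

Lemma convex_set_segment (R : realType) n (A : set 'rV[R]_n) x y (s : R) :
  convex_set (A : set (convex_lmodType 'rV[R]_n)) -> A x -> A y ->
  0 <= s <= 1 -> A (x + s *: (y - x)).
Proof.
move=> cA Ax Ay /andP[s0 s1].
have := cA y x (Itv01 s0 s1); rewrite !inE => /(_ Ay Ax).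
rewrite (_ : x + s *: (y - x) = s *: y + (1 - s) *: x); first exact.
by rewrite scalerBr scalerBl scale1r addrCA.
Qed.

Lemma derive_gradient (R : realType) n (f : 'rV[R]_n -> R) x v :
  differentiable f x -> 'D_v f x = dotp (gradient f x) v.
Proof.
move=> df; rewrite deriveE// [in LHS](row_sum_delta v) linear_sum.
by apply: eq_bigr => j _; rewrite linearZ mxE deriveE// mulrC.
Qed.

(** The difference quotient along the line at [s] is that of [f] at [x + s *: v] in direction
    [v]. *)
Lemma is_derive_line (R : realType) n (f : 'rV[R]_n -> R) x v (s : R) :
  differentiable f (x + s *: v) ->
  is_derive s 1 (fun r => f (x + r *: v)) (dotp (gradient f (x + s *: v)) v).
Proof.
move=> df; rewrite -derive_gradient//.
have quot : (fun h : R => h^-1 *: (f (x + (h *: 1 + s) *: v) - f (x + s *: v)))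
    = (fun h : R => h^-1 *: ((f \o shift (x + s *: v)) (h *: v) - f (x + s *: v))).
  apply/funext => h /=; rewrite -[h *: 1]/(h * 1) mulr1 scalerDl.
  by congr (_ *: (f _ - _)); rewrite addrCA.
have := @diff_derivable _ _ _ f (x + s *: v) v df.
by split; rewrite /derivable /derive /= quot.
Qed.

(** The mean value theorem, applied to [f] along the segment minus its quadratic model, replaces the
    usual integral argument. *)
Lemma descent_lemma (R : realType) n (f : 'rV[R]_n -> R) (A : set 'rV[R]_n)
    (L : R) (x d : 'rV[R]_n) (s : R) :
  (forall y, differentiable f y) ->
  (forall y z, A y -> A z ->
     enorm (gradient f y - gradient f z) <= L * enorm (y - z)) ->
  (forall r, 0 <= r <= 1 -> A (x + r *: d)) -> 0 < s <= 1 ->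
  f (x + s *: d) - f x <=
    2^-1 * L * enorm d ^+ 2 * s ^+ 2 + dotp (gradient f x) d * s.
Proof.
move=> df lip seg /andP[s0 s1].
pose phi (r : R) : R := f (x + r *: d)
  - (2^-1 * L * enorm d ^+ 2 * r ^+ 2 + dotp (gradient f x) d * r).
pose dphi (r : R) : R := dotp (gradient f (x + r *: d)) d
  - (L * enorm d ^+ 2 * r + dotp (gradient f x) d).
have phiD (r : R) : is_derive r (1 : R) phi (dphi r).
  have ? := @is_derive_line _ _ f x d r (df _).
  apply: is_derive_eq; rewrite /dphi.
  by rewrite /GRing.scale/=; field.
have phi_cont : {within `[0, s], continuous phi}.
  apply: continuous_subspaceT => r; apply: differentiable_continuous.
  by apply/derivable1_diffP; case: (phiD r).
have [c + phi_s] := MVT s0 (fun r _ => phiD r) phi_cont.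
rewrite in_itv/= => /andP[c0 cs].
have x0 : x + 0 *: d = x by rewrite scale0r addr0.
have dphi_le0 : dphi c <= 0.
  have Ac : A (x + c *: d) by apply: seg; lra.
  have Ax : A x by rewrite -x0; apply: seg; rewrite lexx ler01.
  (* The Lipschitz bound gives $Lc\|d\|$ for the gradient difference; Cauchy-Schwarz contributes the
     second factor $\|d\|$. *)
  have gradD := lip _ _ Ac Ax; rewrite addrAC subrr add0r enormZ in gradD; last lra.
  rewrite subr_le0 -lerBlDr -dotpBl.
  apply: le_trans (dotp_le_enorm _ _ _ _) _.
  have := ler_wpM2r (enorm_ge0 _ _ d) gradD.
  by congr (_ <= _); ring.
have : phi s - phi 0 <= 0 by rewrite phi_s mulr_le0_ge0// subr0 ltW.
by rewrite /phi x0 expr0n !mulr0 addr0 subr0; lra.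
Qed.

Lemma fmax_ge (R : realType) m (v : 'I_m.+1 -> R) i : v i <= fmax v.
Proof. exact: le_bigmax. Qed.

Lemma fmax_le (R : realType) m (v : 'I_m.+1 -> R) c :
  (forall i, v i <= c) -> fmax v <= c.
Proof. by move=> vc; apply: bigmax_le. Qed.

(** Meant for $a = -\theta$, $l = L_{\max}$, $N = \|d\|^2$ and [D] the squared diameter. The case $N
    = 0$ falls under $lN \le a$, so the division by $lN$ is safe. *)
Lemma quadratic_min_le (R : realType) (a l N D : R) :
  0 < a -> 0 < l -> 0 <= N -> N <= D ->
  exists2 s, 0 <= s <= 1 &
    2^-1 * l * N * s ^+ 2 - a * s <= - (2^-1 * Num.min a (a ^+ 2 / (l * D))).
Proof.
move=> a0 l0 N0 ND; have [lNa|alN] := leP (l * N) a.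
  (* The full step gives $lN/2 - a \le -a/2$. *)
  exists 1; first by rewrite ler01 lexx.
  have : Num.min a (a ^+ 2 / (l * D)) <= a by rewrite ge_min lexx.
  rewrite expr1n !mulr1; lra.
have lN0 : 0 < l * N := lt_trans a0 alN.
have Npos : 0 < N by rewrite -(pmulr_rgt0 _ l0).
(* The vertex of the parabola, which lies inside $[0,1]$; its value $-a^2/(2lN)$ only grows when [N]
   is replaced by [D]. *)
exists (a / (l * N)).
  by rewrite divr_ge0 ?(ltW a0) ?(ltW lN0)//= ler_pdivrMr// mul1r ltW.
have -> : 2^-1 * l * N * (a / (l * N)) ^+ 2 - a * (a / (l * N)) =
    - (2^-1 * (a ^+ 2 / (l * N))).
  by field; rewrite (gt_eqF Npos) (gt_eqF l0).
rewrite lerN2 ler_pM2l ?invr_gt0 ?ltr0n// ge_min; apply/orP; right.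
rewrite ler_pM2l ?exprn_gt0// lef_pV2 ?posrE ?mulr_gt0 ?(lt_le_trans Npos ND)//.
by rewrite ler_pM2l.
Qed.

Theorem proposition4p2 (R : realType) (n m : nat)
    (F : 'rV[R]_n -> 'rV[R]_m.+1) (Omega : set 'rV[R]_n)
    (L : 'I_m.+1 -> R) (p : 'rV[R]_n -> 'rV[R]_n)
    (t : nat -> R) (x : nat -> 'rV[R]_n)
    (F_C1 : continuously_differentiable F)
    (Omega_nonempty : Omega !=set0)
    (Omega_compact : compact Omega)
    (Omega_convex : convex_set (Omega : set (convex_lmodType 'rV[R]_n)))
    (F_lipschitz : lipschitz_gradients F Omega L)
    (p_argmin : subproblem_solution F Omega p)
    (x_mcondg : mcondg_sequence p Omega t x)
    (x_nonterminating : forall k, theta F p (x k) < 0)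
    (t_tas : forall k, tight_adaptive_step F p L (x k) (t k)) :
  exists Lhat : R, 0 < Lhat <= fmax L /\
    forall k,
      vle (F (x k + t k *: direction p (x k)) - F (x k))
          ((- (2^-1 * Num.min (- theta F p (x k))
                       (theta F p (x k) ^+ 2 / (Lhat * diameter Omega ^+ 2))))
             *: const_mx 1).
Proof.
have dF i y : differentiable (objective F i) y.
  exact: differentiable_comp (F_C1.1 y) (differentiable_coord (F y) 0 i).
(* Each iterate is a convex combination of the previous one and a feasible minimizer. *)
have x_in k : Omega (x k).
  elim: k => [|k IHk]; first exact: x_mcondg.1.
  have [/andP[t0 t1] ->] := x_mcondg.2 k.
  apply: convex_set_segment => //; last by rewrite (ltW t0).
  exact: (p_argmin _ IHk).1.
have Lmax_gt0 : 0 < fmax L.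
  exact: lt_le_trans (F_lipschitz ord0).1 (fmax_ge _ _ L ord0).
exists (fmax L); split=> [|k i]; first by rewrite Lmax_gt0 lexx.
have px_in : Omega (p (x k)) := (p_argmin _ (x_in k)).1.
set d := direction p (x k); set a := - theta F p (x k).
have a_gt0 : 0 < a by rewrite oppr_gt0.
have [||s s01 s_le] := quadratic_min_le _ a (fmax L) (enorm d ^+ 2)
  (diameter Omega ^+ 2) a_gt0 Lmax_gt0.
- by rewrite sqr_ge0.
(* [d] joins two feasible points, [x k] and [p (x k)]. *)
- by rewrite lerXn2r ?nnegrE ?(le_trans (enorm_ge0 _ _ d)) ?enorm_ge0 //
    diameter_ge.
rewrite !mxE mulr1 -[theta F p (x k) ^+ 2]sqrrN.
apply: le_trans s_le.
have [t01 t_min] := t_tas k.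
apply: le_trans (_ : max_model F p L (x k) (t k) <= _).
  apply: le_trans (fmax_ge _ _ _ i).
  apply: descent_lemma (dF i) (F_lipschitz i).2 _ (x_mcondg.2 k).1 => r r01.
  exact: convex_set_segment.
apply: le_trans (t_min s _) _; first by rewrite /= in_itv.
case/andP: s01 => s0 s1.
(* Since [s] is nonnegative, the two coefficients compare separately: [L j] with [fmax L], and each
   slope with their maximum [theta]. *)
apply: fmax_le => j; rewrite /quad_model -mulNr opprK.
apply: lerD.
  rewrite ler_wpM2r ?sqr_ge0// ler_wpM2r ?sqr_ge0//.
  by rewrite ler_wpM2l ?invr_ge0 ?ler0n// fmax_ge.
by rewrite ler_wpM2r// (fmax_ge _ _ (fun i => dotp (gradient (objective F i) (x k)) d)).
Qed.
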